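(* The Bell triangle $X=[X_{n,k}]_{n,k\ge 0}$, the Catalan triangle of Aigner $C=[C_{n,k}]_{n,k\ge 0}$, and the Catalan triangle of Shapiro $B=[B_{n,k}]_{n,k\ge 0}$ are each TP.
   Context: A real (finite or infinite) matrix is TP (totally positive) if its minors of all orders are nonnegative. Each of the following is an infinite lower triangular matrix whose $(n,k)$ entry is $0$ unless $n\ge k\ge 0$, and whose $(0,0)$ entry is $1$; the recurrences hold for $n\ge 0$. Bell triangle: $X_{n+1,k}=X_{n,k-1}+(k+1)X_{n,k}+(k+1)X_{n,k+1}$ for $k\ge 0$. Catalan triangle of Aigner: $C_{n+1,0}=C_{n,0}+C_{n,1}$ and $C_{n+1,k}=C_{n,k-1}+2C_{n,k}+C_{n,k+1}$ for $k\ge 1$. Catalan triangle of Shapiro: $B_{n+1,k}=B_{n,k-1}+2B_{n,k}+B_{n,k+1}$ for $k\ge 0$. *)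

(* Defs.v *)
From mathcomp Require Import all_boot all_order all_algebra.

Set Implicit Arguments.
Unset Strict Implicit.
Unset Printing Implicit Defensive.

Import Order.TTheory GRing.Theory Num.Theory.
Local Open Scope ring_scope.

(* Infinite matrices are functions [nat -> nat -> R].  A minor of order [m] is
   given by [m] strictly increasing row indices and [m] strictly increasing
   column indices; the empty minor ([m = 0]) is 1. *)
Definition TP (R : numDomainType) (A : nat -> nat -> R) : Prop :=
  forall (m : nat) (r c : 'I_m -> nat),
    (forall i j : 'I_m, (i < j)%N -> (r i < r j)%N) ->
    (forall i j : 'I_m, (i < j)%N -> (c i < c j)%N) ->
    0 <= \det (\matrix_(i < m, j < m) A (r i) (c j)).

(* In the recurrences an entry with column index -1 is 0.  Row 0 is
   (1, 0, 0, ...); the vanishing above the diagonal in the other rows then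
   follows, see the [_lower] lemmas below. *)
Fixpoint bell_triangle (R : pzRingType) (n k : nat) : R :=
  match n with
  | 0 => (k == 0%N)%:R
  | n'.+1 =>
      (if k is k'.+1 then bell_triangle R n' k' else 0)
      + k.+1%:R * bell_triangle R n' k
      + k.+1%:R * bell_triangle R n' k.+1
  end.

Fixpoint aigner_triangle (R : pzRingType) (n k : nat) : R :=
  match n with
  | 0 => (k == 0%N)%:R
  | n'.+1 =>
      if k is k'.+1 then
        aigner_triangle R n' k' + 2%:R * aigner_triangle R n' k
        + aigner_triangle R n' k.+1
      else aigner_triangle R n' 0 + aigner_triangle R n' 1
  end.

Fixpoint shapiro_triangle (R : pzRingType) (n k : nat) : R :=
  match n with
  | 0 => (k == 0%N)%:R
  | n'.+1 =>
      (if k is k'.+1 then shapiro_triangle R n' k' else 0)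
      + 2%:R * shapiro_triangle R n' k
      + shapiro_triangle R n' k.+1
  end.

Lemma bell_triangle_lower (R : pzRingType) (n k : nat) :
  (n < k)%N -> bell_triangle R n k = 0.
Proof.
elim: n k => [|n IHn] [|k] //= ltnk.
by rewrite !IHn ?mulr0 ?addr0 // ltnW // ltnW.
Qed.

Lemma aigner_triangle_lower (R : pzRingType) (n k : nat) :
  (n < k)%N -> aigner_triangle R n k = 0.
Proof.
elim: n k => [|n IHn] [|k] //= ltnk.
by rewrite !IHn ?mulr0 ?addr0 // ltnW // ltnW.
Qed.

Lemma shapiro_triangle_lower (R : pzRingType) (n k : nat) :
  (n < k)%N -> shapiro_triangle R n k = 0.
Proof.
elim: n k => [|n IHn] [|k] //= ltnk.
by rewrite !IHn ?mulr0 ?addr0 // ltnW // ltnW.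
Qed.

(* Main.v *)
Require Import Defs.
From mathcomp Require Import all_boot all_order all_algebra.
From mathcomp Require Import zify.

(** Each of the three triangles has row 0 equal to (1, 0, 0, ...) and satisfies,
    for suitable nonnegative sequences [a] and [b], the recurrence
      [A n.+1 k = A n k.-1 + (a k + b k) * A n k + a k * b k.+1 * A n k.+1],
    where the first term is absent for [k = 0].
    Let [1 (+) A] be [A] bordered by a new row and column 0 with a single 1 in
    the corner.  The recurrence says exactly that [A] arises from [1 (+) A] by
    two sweeps of column operations, first [X_k + b k * X_(k+1)] and then
    [X_k + a k * X_(k+1)] (lemma [bidiagonal_recurrence]).  A sweep preserves
    total positivity ([TP_rows_col_sweep]): expanding a minor by multilinearity
    in its columns yields nonnegative multiples of determinants whose column
    indices are [c j] or [(c j).+1]; these indices are weakly increasing, so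
    such a determinant is either a minor or has two equal columns.  Bordering
    carries total positivity of the first [N] rows to that of the first [N.+1]
    rows ([TP_rows_border]), so induction on the number of rows concludes.

    The parameters are [a = 1] throughout, with [b k = k] for the Bell triangle,
    [b 0 = 0] and [b k.+1 = 1] for Aigner's triangle, and [b = 1] for Shapiro's
    triangle. *)

Set Implicit Arguments.
Unset Strict Implicit.
Unset Printing Implicit Defensive.

Import Order.TTheory GRing.Theory Num.Theory.
Local Open Scope ring_scope.

(** Nonnegativity of all minors of [A] that use only rows of index below [N]. *)
Definition TP_rows (R : numDomainType) (N : nat) (A : nat -> nat -> R) : Prop :=
  forall (m : nat) (r c : 'I_m -> nat),
    (forall i, (r i < N)%N) ->
    (forall i j : 'I_m, (i < j)%N -> (r i < r j)%N) ->
    (forall i j : 'I_m, (i < j)%N -> (c i < c j)%N) ->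
    0 <= \det (\matrix_(i < m, j < m) A (r i) (c j)).

(** The block sum [1 (+) A]. *)
Definition border (R : pzRingType) (A : nat -> nat -> R) (n k : nat) : R :=
  match n, k with
  | 0, _ => (k == 0%N)%:R
  | n'.+1, 0 => 0
  | n'.+1, k'.+1 => A n' k'
  end.

(** The product of [A] with the lower bidiagonal matrix that has diagonal
    entries 1 and subdiagonal entries [e 0], [e 1], ... *)
Definition col_sweep (R : pzRingType) (e : nat -> R) (A : nat -> nat -> R)
    (n k : nat) : R :=
  A n k + e k * A n k.+1.

Lemma TP_of_TP_rows (R : numDomainType) (A : nat -> nat -> R) :
  (forall N, TP_rows N A) -> TP A.
Proof.
move=> tpA m r c hr hc; apply: (tpA (\max_(i < m) r i).+1) => // i.
by rewrite ltnS (leq_bigmax i).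
Qed.

Lemma eq_TP_rows (R : numDomainType) (N : nat) (A B : nat -> nat -> R) :
  (forall n k, A n k = B n k) -> TP_rows N A -> TP_rows N B.
Proof.
move=> eqAB tpA m r c hN hr hc.
rewrite (_ : \matrix_(i, j) _ = \matrix_(i < m, j < m) A (r i) (c j)).
  exact: tpA.
by apply/matrixP => i j; rewrite !mxE.
Qed.

(** The column indices of a minor may be taken only weakly increasing, since a
    repeated column makes the determinant vanish. *)
Lemma TP_rows_weak (R : numDomainType) (N : nat) (A : nat -> nat -> R) (m : nat)
    (r c : 'I_m -> nat) :
  TP_rows N A -> (forall i, (r i < N)%N) ->
  (forall i j : 'I_m, (i < j)%N -> (r i < r j)%N) ->
  (forall i j : 'I_m, (i < j)%N -> (c i <= c j)%N) ->
  0 <= \det (\matrix_(i < m, j < m) A (r i) (c j)).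
Proof.
move=> tpA hN hr hc.
have [/existsP [i /existsP [j /andP [ltij /eqP eqc]]]|nex] :=
  boolP [exists i : 'I_m, exists j : 'I_m, (i < j)%N && (c i == c j)].
  rewrite -det_tr (determinant_alternate (i1 := i) (i2 := j)) //.
    by apply: contraL ltij => /eqP ->; rewrite ltnn.
  by move=> k; rewrite !mxE eqc.
apply: tpA => // i j ltij; rewrite ltn_neqAle hc // andbT.
by apply: contra nex => eqc; apply/existsP; exists i; apply/existsP; exists j;
  rewrite ltij.
Qed.

(** If every matrix obtained by taking each row from [U] or from [V] has
    nonnegative determinant, then so has the matrix with rows
    [U_i + e i * V_i], for nonnegative [e]. *)
Lemma det_row_choice_ge0 (R : numDomainType) (m : nat) (U V : 'M[R]_m)
    (e : 'I_m -> R) :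
  (forall i, 0 <= e i) ->
  (forall f : 'I_m -> bool,
     0 <= \det (\matrix_(i, j) if f i then V i j else U i j)) ->
  0 <= \det (\matrix_(i, j) (U i j + e i * V i j)).
Proof.
move=> e0 hUV.
(* The rows of index below [t] are sums; the others are still chosen. *)
have step t (f : 'I_m -> bool) : (t <= m)%N ->
    0 <= \det (\matrix_(i, j) if (i < t)%N then U i j + e i * V i j
                              else if f i then V i j else U i j).
  elim: t f => [|t IHt] f ltm.
    by have := hUV f; congr (0 <= \det _); apply/matrixP => i j; rewrite !mxE.
  pose i0 := Ordinal ltm.
  pose M b := \matrix_(i, j) if (i < t)%N then U i j + e i * V i j
      else if (if i == i0 then b else f i) then V i j else U i j.
  have M0 b : 0 <= \det (M b) by apply: IHt; apply: ltnW.
  have lift_i0 i :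
      ((lift i0 i == i0) = false) * ((lift i0 i == t :> nat) = false).
    by have := negPf (neq_lift i0 i); rewrite eq_sym; split.
  rewrite (@determinant_multilinear _ _ _ (M false) (M true) i0 1 (e i0)).
  - by rewrite mul1r addr_ge0 // mulr_ge0.
  - by apply/rowP => j; rewrite !mxE /= ltnSn ltnn eqxx mul1r.
  - by apply/matrixP => i j; rewrite !mxE ltnS [in RHS]leq_eqVlt !(lift_i0 i).
  by apply/matrixP => i j; rewrite !mxE ltnS [in RHS]leq_eqVlt !(lift_i0 i).
have := step m (fun=> false) (leqnn m).
by congr (0 <= \det _); apply/matrixP => i j; rewrite !mxE ltn_ord.
Qed.

Lemma TP_rows_col_sweep (R : numDomainType) (N : nat) (e : nat -> R)
    (A : nat -> nat -> R) :
  (forall k, 0 <= e k) -> TP_rows N A -> TP_rows N (col_sweep e A).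
Proof.
move=> e0 tpA m r c hN hr hc; rewrite -det_tr.
pose U := \matrix_(j < m, i < m) A (r i) (c j).
pose V := \matrix_(j < m, i < m) A (r i) (c j).+1.
rewrite (_ : _^T = \matrix_(j, i) (U j i + e (c j) * V j i)); last first.
  by apply/matrixP => i j; rewrite !mxE.
apply: det_row_choice_ge0 => [//|f]; rewrite -det_tr.
rewrite (_ : _^T = \matrix_(i < m, j < m) A (r i) (f j + c j)%N); last first.
  by apply/matrixP => i j; rewrite !mxE; case: (f j).
apply: (TP_rows_weak tpA) => // i j /hc ltc.
by case: (f i); case: (f j) => //; rewrite ?add0n ?add1n; lia.
Qed.

Lemma TP_rows_border (R : numDomainType) (N : nat) (A : nat -> nat -> R) :
  TP_rows N A -> TP_rows N.+1 (border A).
Proof.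
move=> tpA [|m] r c hN hr hc; first by rewrite det_mx00.
(* Away from the corner row and column, the minor is one of [A]. *)
have inner p (r' c' : 'I_p -> nat) :
    (forall i, 0 < r' i < N.+1)%N -> (forall j, 0 < c' j)%N ->
    (forall i j : 'I_p, (i < j)%N -> (r' i < r' j)%N) ->
    (forall i j : 'I_p, (i < j)%N -> (c' i < c' j)%N) ->
    0 <= \det (\matrix_(i < p, j < p) border A (r' i) (c' j)).
  move=> r0 c0 hr' hc'.
  rewrite (_ : \matrix_(i, j) _ =
      \matrix_(i < p, j < p) A (r' i).-1 (c' j).-1); last first.
    apply/matrixP => i j; rewrite !mxE.
    by case: (r' i) (r0 i) => // n _; case: (c' j) (c0 j).
  apply: tpA => [i|i j /hr'|i j /hc'].
  - by have := r0 i; case: (r' i).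
  - by have := r0 i; case: (r' i) => // n _; case: (r' j).
  - by have := c0 i; case: (c' i) => // n _; case: (c' j).
have pos (g : 'I_m.+1 -> nat) (i : 'I_m.+1) :
    (forall i j : 'I_m.+1, (i < j)%N -> (g i < g j)%N) ->
    (0 < i)%N || (0 < g ord0)%N -> (0 < g i)%N.
  move=> hg; case: (posnP i) => [i0|i_gt0 _].
    by rewrite (_ : i = ord0) //; apply: val_inj.
  exact: leq_ltn_trans (hg ord0 i i_gt0).
have [r0|r0] := posnP (r ord0); have [c0|c0] := posnP (c ord0).
- rewrite (expand_det_row _ ord0) big_ord_recl big1 => [|j _]; last first.
    rewrite mxE r0 /= (_ : (c _ == _) = false) ?mul0r //.
    by apply/negbTE; rewrite -lt0n pos.
  rewrite mxE r0 c0 /= mul1r addr0 /cofactor expr0 mul1r.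
  rewrite (_ : row' ord0 (col' ord0 _) = \matrix_(i < m, j < m)
      border A (r (lift ord0 i)) (c (lift ord0 j))); last first.
    by apply/matrixP => i j; rewrite !mxE.
  apply: (inner m (r \o lift ord0) (c \o lift ord0)) => /= [i|j|i j ij|i j ij].
  - by rewrite hN andbT; apply: pos.
  - exact: pos.
  - exact: hr.
  - exact: hc.
- rewrite (expand_det_row _ ord0) big1 // => j _.
  rewrite mxE r0 /= (_ : (c _ == _) = false) ?mul0r //.
  by apply/negbTE; rewrite -lt0n pos // c0 orbT.
- rewrite (expand_det_col _ ord0) big1 // => i _.
  have : (0 < r i)%N by rewrite pos // r0 orbT.
  by rewrite mxE c0; case: (r i) => //= n _; rewrite mul0r.
apply: inner => // [i|j]; last by rewrite pos // c0 orbT.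
by rewrite hN andbT pos // r0 orbT.
Qed.

Lemma bidiagonal_recurrence (R : comPzRingType) (a b : nat -> R)
    (A : nat -> nat -> R) :
  (forall k, A 0 k = (k == 0%N)%:R) ->
  (forall n k, A n.+1 k = (if k is k'.+1 then A n k' else 0)
     + (a k + b k) * A n k + a k * b k.+1 * A n k.+1) ->
  forall n k, col_sweep a (col_sweep b (border A)) n k = A n k.
Proof.
move=> A0 AS [|n] k; rewrite /col_sweep ?A0 ?AS /=.
  by rewrite !(mulr0, addr0).
rewrite -!addrA; congr (_ + _).
by rewrite mulrDr mulrDl mulrA !addrA [b k * _ + _]addrC.
Qed.

Lemma TP_bidiagonal_recurrence (R : numDomainType) (a b : nat -> R)
    (A : nat -> nat -> R) :
  (forall k, 0 <= a k) -> (forall k, 0 <= b k) ->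
  (forall k, A 0 k = (k == 0%N)%:R) ->
  (forall n k, A n.+1 k = (if k is k'.+1 then A n k' else 0)
     + (a k + b k) * A n k + a k * b k.+1 * A n k.+1) ->
  TP A.
Proof.
move=> a0 b0 A0 AS; apply: TP_of_TP_rows; elim=> [|N IHN].
  by move=> [|m] r c hN; [rewrite det_mx00 | have := hN ord0].
apply: eq_TP_rows (bidiagonal_recurrence A0 AS) _.
by do 2![apply: TP_rows_col_sweep => //]; apply: TP_rows_border.
Qed.

Theorem corollary2p12 (R : realFieldType) :
  TP (bell_triangle R) /\ TP (aigner_triangle R) /\ TP (shapiro_triangle R).
Proof.
split; last split.
- apply: (@TP_bidiagonal_recurrence _ (fun=> 1) (fun k => k%:R)) => // n k.
  by rewrite mul1r nat1r.
- apply: (@TP_bidiagonal_recurrence _ (fun=> 1) (fun k => (0 < k)%:R)) => //.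
  by move=> n [|k] /=; rewrite ?addr0 ?add0r !mul1r.
apply: (@TP_bidiagonal_recurrence _ (fun=> 1) (fun=> 1)) => // n k.
by rewrite /= !mul1r.
Qed.
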